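(* Consider a finite MDP $\langle\mathcal S,\mathcal A,(\mathcal A(s),s\in\mathcal S),P,r\rangle$, a horizon $T\ge1$, $\alpha\in(0,1]$ and a given initial state $s_0\in\mathcal S$. Starting from any initial policy $u^{(0)}\in\mathcal U^{\rm DH}$, the policy iteration algorithm for finite-horizon VaR maximization (described in the context) stops after finitely many iterations, and the policy $u^{(n)}$ at which it stops is optimal for the finite-horizon VaR maximization MDP with initial state $s_0$, i.e. $\mathrm{VaR}^{u^{(n)}}(s_0)=\mathrm{VaR}^*(s_0):=\sup_{u\in\mathcal U^{\rm RH}}\mathrm{VaR}^u(s_0)$.
   Context: MDP: $\mathcal S$ and $\mathcal A$ are finite sets; $\mathcal A(s)\subseteq\mathcal A$ is the nonempty set of admissible actions in $s$, with $\cup_s\mathcal A(s)=\mathcal A$; $\mathcal K:=\{(s,a):s\in\mathcal S,a\in\mathcal A(s)\}$; $P(\cdot|s,a)$ is a probability distribution on $\mathcal S$ for each $(s,a)\in\mathcal K$; $r:\mathcal K\to\mathbb R$ is the reward function. Policies: $\mathcal U^{\rm RH}$ is the set of randomized history-dependent policies $u=(u_t)_{t}$, where $u_t(\cdot|h_t)$ is a probability distribution on $\mathcal A(s_t)$ for each history $h_t=(s_0,a_0,\dots,s_{t-1},a_{t-1},s_t)\in\mathcal K^t\times\mathcal S$; $\mathcal U^{\rm DH}$ is the subset of deterministic ones ($u_t(h_t)\in\mathcal A(s_t)$); since the horizon is $T$, only $u_0,\dots,u_{T-1}$ matter. $\mathbb P^u_{s_0}$ is the law of $(s_0,a_0,s_1,a_1,\dots)$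 under $u$ started from $s_0$. Finite-horizon quantities: $R_{0:T}:=\sum_{t=0}^{T-1}r(s_t,a_t)$ (the terminal reward is zero); $\Lambda_0:=\{\sum_{t=0}^{T-1}r(s_t,a_t):(s_t,a_t)\in\mathcal K\text{ for all }t\}$; $F^u(s_0,\lambda_0):=\mathbb P^u_{s_0}(R_{0:T}\le\lambda_0)$; $F^*(s_0,\lambda_0):=\inf_{u\in\mathcal U^{\rm RH}}F^u(s_0,\lambda_0)$; $\mathrm{VaR}^u(s_0):=\inf\{\lambda\in\mathbb R:F^u(s_0,\lambda)\ge\alpha\}=\min\{\lambda_0\in\Lambda_0:F^u(s_0,\lambda_0)\ge\alpha\}$. Augmented MDP: state space $\mathcal S\times\mathbb R$, admissible actions $\mathcal A(s)$ in state $(s,\lambda)$; from $(s_t,\lambda_t)$ with action $a_t$ the next state is $(s_{t+1},\lambda_{t+1})$ with $s_{t+1}\sim P(\cdot|s_t,a_t)$ and $\lambda_{t+1}=\lambda_t-r(s_t,a_t)$; the only nonzero reward is the terminal reward $\mathbb I\{0\le\lambda_T\}$. $\tilde{\mathcal U}^{\rm DM}$ is the set of deterministic Markov policies $\tilde u=(\tilde u_0,\dots,\tilde u_{T-1})$, $\tilde u_t:\mathcal S\times\mathbb R\to\mathcal A$ with $\tilde u_t(s,\lambda)\in\mathcal A(s)$. $V_0^{\tilde u}(s_0,\lambda_0):=\mathbb E^{\tilde u}_{s_0,\lambda_0}[\mathbb I\{0\le\lambda_T\}]$. Algorithm (for given $s_0$). Choose $u^{(0)}\in\mathcal U^{\rm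 DH}$ arbitrarily and set $k=0$. At iteration $k$: (policy evaluation) compute $\lambda_0^{(k)}:=\mathrm{VaR}^{u^{(k)}}(s_0)$; (policy improvement) solve the augmented MDP to obtain $V_0^*(s_0,\lambda_0^{(k)})=\min_{\tilde u\in\tilde{\mathcal U}^{\rm DM}}V_0^{\tilde u}(s_0,\lambda_0^{(k)})$, which equals $F^*(s_0,\lambda_0^{(k)})$, and a minimizer $\tilde u^*\in\arg\min_{\tilde u\in\tilde{\mathcal U}^{\rm DM}}V_0^{\tilde u}(s_0,\lambda_0^{(k)})$, and define $u'\in\mathcal U^{\rm DH}$ by $u'_t(s_0,a_0,\dots,s_t):=\tilde u^*_t\big(s_t,\lambda_0^{(k)}-\sum_{\tau=0}^{t-1}r(s_\tau,a_\tau)\big)$, $t=0,\dots,T-1$. If $F^*(s_0,\lambda_0^{(k)})<\alpha$, set $u^{(k+1)}:=u'$, increase $k$ by one, and repeat; otherwise stop and return $u^{(k)}$ and $\mathrm{VaR}^{u^{(k)}}(s_0)$. *)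

(* Defs.v *)
From HB Require Import structures.
From mathcomp Require Import all_boot all_order all_algebra.
From mathcomp Require Import all_classical all_reals.

Set Implicit Arguments.
Unset Strict Implicit.
Unset Printing Implicit Defensive.

Import Order.TTheory GRing.Theory Num.Theory.

Local Open Scope classical_set_scope.
Local Open Scope ring_scope.

(* Sums [\sum_(x \in B) f x] are the finitely supported sums of fsbigop (0 by
   convention when the support is infinite); total mass 1 therefore forces [q]
   to be finitely supported. *)
Definition is_distr (R : realType) (X : choiceType) (B : set X) (q : X -> R) :=
  [/\ forall x, 0 <= q x,
      forall x, ~ B x -> q x = 0
    & \sum_(x \in [set: X]) q x = 1].

(* The state space is only a choiceType, so that the same structure covers the
   MDP on a finite set S and its augmentation on S * R.  [trans] and [rew] are
   meaningful only at pairs (x, a) with [a \in adm x]. *)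
Record mdp (R : realType) (X : choiceType) (A : finType) := Mdp {
  adm : X -> {set A};
  trans : X -> A -> X -> R;
  rew : X -> A -> R;
  adm_neq0 : forall x, exists a, a \in adm x;
  adm_cover : forall a, exists x, a \in adm x;
  trans_distr : forall x a, a \in adm x -> is_distr setT (trans x a)
}.

(* A history (x_0, a_0, ..., x_{t-1}, a_{t-1}, x_t) is split into the sequence
   of its pairs (x_i, a_i) and its current state x_t; the time t is the size of
   that sequence. *)
Definition rpolicy (R : realType) (X : choiceType) (A : finType) :=
  seq (X * A) -> X -> A -> R.
Definition dpolicy (X : choiceType) (A : finType) := seq (X * A) -> X -> A.
Definition mpolicy (X : choiceType) (A : finType) := nat -> X -> A.

Section Policies.
Variables (R : realType) (X : choiceType) (A : finType) (M : mdp R X A).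

Definition admissible_past (h : seq (X * A)) : bool :=
  all (fun z => z.2 \in adm M z.1) h.

Definition RH (T : nat) (u : rpolicy R X A) : Prop :=
  forall h x, (size h < T)%N -> admissible_past h ->
    is_distr [set a | a \in adm M x] (u h x).

Definition DH (T : nat) (u : dpolicy X A) : Prop :=
  forall h x, (size h < T)%N -> admissible_past h -> u h x \in adm M x.

Definition DM (T : nat) (u : mpolicy X A) : Prop :=
  forall t x, (t < T)%N -> u t x \in adm M x.

Definition rand (u : dpolicy X A) : rpolicy R X A :=
  fun h x a => (a == u h x)%:R.

Definition dpolicy_of_markov (u : mpolicy X A) : dpolicy X A :=
  fun h x => u (size h) x.

(* State at time t of the trajectory (x_0, a_0, ..., x_{T-1}, a_{T-1}, x_T),
   encoded like a history of size T; for t = T, [nth] returns its default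
   value x_T. *)
Definition state_at (T : nat) (w : T.-tuple (X * A) * X) (t : nat) : X :=
  nth w.2 [seq z.1 | z <- w.1] t.

Definition law (T : nat) (u : rpolicy R X A) (x0 : X)
    (w : T.-tuple (X * A) * X) : R :=
  (state_at w 0 == x0)%:R *
  \prod_(t < T) (u (take t w.1) (state_at w t) (tnth w.1 t).2 *
                 trans M (state_at w t) (tnth w.1 t).2 (state_at w t.+1)).

Definition total_reward (T : nat) (w : T.-tuple (X * A) * X) : R :=
  \sum_(t < T) rew M (state_at w t) (tnth w.1 t).2.

Definition expectation (T : nat) (u : rpolicy R X A) (x0 : X)
    (f : T.-tuple (X * A) * X -> R) : R :=
  \sum_(w \in [set: T.-tuple (X * A) * X]) (law u x0 w * f w).

End Policies.

Section ValueAtRisk.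
Variables (R : realType) (S A : finType) (M : mdp R S A) (T : nat).

(* F^u(s0, lambda) = P^u_{s0}(R_{0:T} <= lambda) *)
Definition cdf (u : rpolicy R S A) (s0 : S) (lambda : R) : R :=
  \sum_(w \in [set w : T.-tuple (S * A) * S | total_reward M w <= lambda])
     law M u s0 w.

(* [inf] and [sup] are the total operators on sets of reals; for 0 < alpha <= 1
   every set below is nonempty and bounded on the relevant side. *)
Definition cdf_star (s0 : S) (lambda : R) : R :=
  inf [set cdf u s0 lambda | u in [set u | RH M T u]].

Definition VaR (alpha : R) (u : rpolicy R S A) (s0 : S) : R :=
  inf [set lambda | alpha <= cdf u s0 lambda].

Definition VaR_star (alpha : R) (s0 : S) : R :=
  sup [set VaR alpha u s0 | u in [set u | RH M T u]].

End ValueAtRisk.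

Section Augmented.
Variables (R : realType) (X : choiceType) (A : finType) (M : mdp R X A).

Definition aug_trans (x : X * R) (a : A) (y : X * R) : R :=
  trans M x.1 a y.1 * (y.2 == x.2 - rew M x.1 a)%R%:R.

Fact aug_neq0 (x : X * R) : exists a, a \in adm M x.1.
Proof. exact: adm_neq0. Qed.

Fact aug_cover (a : A) : exists x : X * R, a \in adm M x.1.
Proof. by have [x ax] := adm_cover M a; exists (x, 0). Qed.

Fact aug_distr (x : X * R) (a : A) :
  a \in adm M x.1 -> is_distr setT (aug_trans x a).
Proof.
move=> /(trans_distr (m := M)) [p0 _ p1]; split => [y|y|].
- by rewrite mulr_ge0.
- by move=> /(_ I).
pose h (s : X) := (s, x.2 - rew M x.1 a).
rewrite -(@fsbig_widen _ _ _ _ (h @` setT)) //; last first.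
  move=> [s l] /= [_ nh]; rewrite /aug_trans /=.
  case: eqP => [e|_]; last by rewrite mulr0.
  by case: nh; exists s; rewrite // /h e.
rewrite fsbig_image; last by move=> s t _ _ [].
by rewrite -[RHS]p1; apply: eq_fsbigr => s _; rewrite /aug_trans /= eqxx mulr1.
Qed.

(* The running reward is zero; the terminal reward is [aug_terminal]. *)
Definition aug : mdp R (X * R)%type A :=
  @Mdp R (X * R)%type A (fun x => adm M x.1) aug_trans (fun _ _ => 0)
    aug_neq0 aug_cover aug_distr.

Definition aug_terminal (x : X * R) : R := (0 <= x.2)%R%:R.

Definition aug_value (T : nat) (u : mpolicy (X * R)%type A) (s0 : X)
    (lambda0 : R) : R :=
  expectation aug (rand R (dpolicy_of_markov u)) (s0, lambda0)
    (fun w : T.-tuple ((X * R) * A) * (X * R) => aug_terminal (state_at w T)).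

Definition aug_argmin (T : nat) (s0 : X) (lambda0 : R)
    (u : mpolicy (X * R)%type A) : Prop :=
  DM aug T u /\
  forall v, DM aug T v -> aug_value T u s0 lambda0 <= aug_value T v s0 lambda0.

Definition lift_policy (lambda0 : R) (u : mpolicy (X * R)%type A) :
    dpolicy X A :=
  fun h s => u (size h) (s, lambda0 - \sum_(z <- h) rew M z.1 z.2).

End Augmented.

Section Algorithm.
Variables (R : realType) (S A : finType) (M : mdp R S A) (T : nat).
Variables (alpha : R) (s0 : S).

(* [improvement u u'] is a relation because the minimizer is arbitrary. *)
Definition improvement (u u' : dpolicy S A) : Prop :=
  let lambda := VaR M T alpha (rand R u) s0 in
  exists2 v, aug_argmin M T s0 lambda v & u' = lift_policy M lambda v.

Definition continues (u : dpolicy S A) : bool :=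
  cdf_star M T s0 (VaR M T alpha (rand R u) s0) < alpha.

(* Terms of [run] after the first policy failing [continues] are irrelevant,
   hence unconstrained. *)
Definition execution (run : nat -> dpolicy S A) : Prop :=
  forall k, continues (run k) -> improvement (run k) (run k.+1).

Definition stops_at (run : nat -> dpolicy S A) (n : nat) : Prop :=
  (forall k, (k < n)%N -> continues (run k)) /\ ~~ continues (run n).

End Algorithm.

(* Main.v *)
(* Bellman's recursion gives a function opt_cdf that bounds every F^u from below
   and is attained by a greedy policy in (state, remaining level); a policy of
   the augmented MDP has the same value as its lift, since the second component
   of an augmented trajectory is determined by the first.  Hence the improved
   policy u' satisfies F^{u'}(VaR^u) = F^*(VaR^u).  As VaR^u is a generalized
   inverse, alpha <= F^u(l) iff VaR^u <= l: if F^*(VaR^u) < alpha then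
   VaR^{u'} > VaR^u, and otherwise alpha <= F^{u1}(VaR^u), that is
   VaR^{u1} <= VaR^u, for every u1.  VaR takes its values among the finitely many
   total rewards, so the strict increase stops. *)
Require Import Defs.
From mathcomp Require Import all_boot all_order all_algebra.
From mathcomp Require Import all_classical all_reals.
Import Order.TTheory GRing.Theory Num.Theory.
Local Open Scope ring_scope.
Set Implicit Arguments.
Unset Strict Implicit.

(** * Finite sums and quantiles of finite distributions *)

Lemma fsbig_setT (R : realType) (I : finType) (f : I -> R) :
  \sum_(i \in [set: I]%classic) f i = \sum_i f i.
Proof.
rewrite (bigfs _ (index_enum_uniq I)) => [|i]; last by rewrite mem_index_enum.
by apply: eq_fsbigl; apply/seteqP; split.
Qed.

(** The sublevel mass is a nondecreasing step function that jumps only at values of [X], so the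
    least value of [X] with mass at least [alpha] is the quantile. *)
Lemma quantileP (R : realType) (W : finType) (p X : W -> R) (alpha : R) :
  (forall w, 0 <= p w) -> \sum_w p w = 1 -> 0 < alpha -> alpha <= 1 ->
  let q := inf [set l | alpha <= \sum_(w | X w <= l) p w]%classic in
  (exists w, q = X w) /\
  forall l, (alpha <= \sum_(w | X w <= l) p w) = (q <= l).
Proof.
move=> p0 p1 a0 a1; set G := fun l => \sum_(w | X w <= l) p w.
have G_mono l m : l <= m -> G l <= G m.
  move=> lm; rewrite /G (bigID (fun w => X w <= l) (fun w => X w <= m)) /=.
  rewrite [X in _ <= X + _](eq_bigl (fun w => X w <= l)).
    by rewrite lerDl sumr_ge0.
  by move=> w; apply: andb_idl => /le_trans; apply.
have G_atom l : alpha <= G l -> exists2 w, alpha <= G (X w) & X w <= l.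
  (* Lowering [l] to the largest value of [X] below it leaves the sublevel set unchanged;
     [0 < alpha] excludes an empty one. *)
  move=> aG; have [w wl|none] := pickP (fun w => X w <= l); last first.
    by move: aG; rewrite /G big_pred0 // leNgt a0.
  case: (@arg_maxP _ _ _ w (fun w => X w <= l) X wl) => v vl vmax.
  exists v => //; apply: le_trans aG _; rewrite le_eqVlt; apply/orP; left.
  apply/eqP/eq_bigl => i; apply/idP/idP => [/vmax //|iv].
  exact: le_trans iv vl.
(* The sum of all [|X w|] dominates every value of [X], so the mass there is 1, which is at least
   [alpha]. *)
have [w1 w1P _] : exists2 w, alpha <= G (X w) & X w <= \sum_w `|X w|.
  apply: G_atom; rewrite /G (eq_bigl xpredT) ?p1 // => w.
  rewrite (bigD1 w) //=; apply: le_trans (ler_norm _) _.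
  by rewrite lerDl sumr_ge0.
case: (@arg_minP _ _ _ w1 (fun w => alpha <= G (X w)) X w1P) => w0 w0P w0min.
have Gw0 l : (alpha <= G l) = (X w0 <= l).
  apply/idP/idP => [/G_atom[w /w0min w0w wl]|/G_mono]; last exact: le_trans.
  exact: le_trans w0w wl.
have qE : inf [set l | alpha <= G l]%classic = X w0.
  apply/eqP; rewrite eq_le; apply/andP; split.
    by apply: ge_inf => //; exists (X w0) => l /=; rewrite Gw0.
  by apply: lb_le_inf; [exists (X w0)|move=> l /=; rewrite Gw0].
by rewrite /= qE; split; [exists w0|].
Qed.

(** * Splitting off the first step of a trajectory *)

Definition cons_traj (T : nat) (Z X : Type) (z : Z) (w : T.-tuple Z * X) :
  T.+1.-tuple Z * X := ([tuple of z :: w.1], w.2).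

(** The continuation of [u] once the first pair [z] has been observed; inductions on the horizon
    pass to it. *)
Definition shift_policy (R : realType) (X : choiceType) (A : finType)
    (u : rpolicy R X A) (z : X * A) : rpolicy R X A := fun h => u (z :: h).

Lemma law_cons (R : realType) (X : choiceType) (A : finType) (M : mdp R X A)
    (T : nat) (u : rpolicy R X A) (x0 : X) (z : X * A)
    (w : T.-tuple (X * A) * X) :
  law M u x0 (cons_traj z w) =
  (z.1 == x0)%:R * (u [::] z.1 z.2 * trans M z.1 z.2 (state_at w 0)) *
  law M (shift_policy u z) (state_at w 0) w.
Proof.
rewrite /law big_ord_recl !mulrA eqxx mulr1 tnth0; congr (_ * _).
by apply: eq_bigr => t _; rewrite tnthS.
Qed.

Lemma total_reward_cons (R : realType) (S A : finType) (M : mdp R S A)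
    (T : nat) (z : S * A) (w : T.-tuple (S * A) * S) :
  total_reward M (cons_traj z w) = rew M z.1 z.2 + total_reward M w.
Proof.
rewrite /total_reward big_ord_recl tnth0; congr (_ + _).
by apply: eq_bigr => t _; rewrite tnthS.
Qed.

(** * Trajectory laws and Bellman's recursion on a finite MDP *)

Section FiniteMdp.
Variables (R : realType) (S A : finType) (M : mdp R S A).
Implicit Types (u : rpolicy R S A) (s : S) (T : nat).

Lemma trans_ge0 s a y : a \in adm M s -> 0 <= trans M s a y.
Proof. by move=> /(trans_distr (m := M)) []. Qed.

Lemma sum_trans s a : a \in adm M s -> \sum_y trans M s a y = 1.
Proof.
by move=> /(trans_distr (m := M)) [_ _ <-]; rewrite fsbig_setT.
Qed.

Lemma sum_law0 u s (f : 0.-tuple (S * A) * S -> R) :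
  \sum_w law M u s w * f w = f ([tuple], s).
Proof.
rewrite (bigD1 ([tuple], s)) //= big1 => [|[t x] tx].
  by rewrite /law /state_at /= eqxx big_ord0 !mul1r addr0.
rewrite /law /state_at; move: tx; rewrite (tuple0 t) /= xpair_eqE eqxx /=.
by move=> /negPf ->; rewrite !mul0r.
Qed.

(** Conditioning on the first action and the next state; every later induction on the horizon rests
    on it. *)
Lemma sum_law_recl T u s (f : T.+1.-tuple (S * A) * S -> R) :
  \sum_w law M u s w * f w =
  \sum_a u [::] s a * \sum_y trans M s a y *
    \sum_w law M (shift_policy u (s, a)) y w * f (cons_traj (s, a) w).
Proof.
pose g (p : (S * A) * (T.-tuple (S * A) * S)) := cons_traj p.1 p.2.
pose g' (w : T.+1.-tuple (S * A) * S) := (thead w.1, ([tuple of behead w.1], w.2)).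
rewrite (reindex g) /=; last first.
  exists g' => -[].
    by move=> z [w y] _; congr (_, (_, _)); apply: val_inj.
  by move=> w y _; rewrite /g /cons_traj /= -tuple_eta.
rewrite -(pair_bigA _ (fun z w => law M u s (cons_traj z w) * f (cons_traj z w))).
pose F x a := \sum_w law M u s (cons_traj (x, a) w) * f (cons_traj (x, a) w).
rewrite (eq_bigr (fun z => F z.1 z.2)) => [|[] //].
rewrite -(pair_bigA _ F) /F /=.
rewrite (bigD1 s) //= [X in _ + X]big1 ?addr0; last first.
  move=> x /negPf xs; rewrite big1 // => a _; rewrite big1 // => w _.
  by rewrite law_cons /= xs !mul0r.
apply: eq_bigr => a _; rewrite mulr_sumr.
under [RHS]eq_bigr => y _ do rewrite mulr_sumr mulr_sumr.
rewrite exchange_big /=; apply: eq_bigr => w _.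
(* For a fixed tail [w] only its own initial state contributes to the sum over [y]. *)
rewrite (bigD1 (state_at w 0)) //= [X in _ + X]big1 ?addr0; last first.
  by move=> y yw; rewrite /law eq_sym (negPf yw) !mul0r !mulr0.
by rewrite law_cons /= eqxx mul1r !mulrA.
Qed.

Lemma RH_action0 T u s : RH M T.+1 u ->
  [/\ forall a, 0 <= u [::] s a, forall a, a \notin adm M s -> u [::] s a = 0
    & \sum_a u [::] s a = 1].
Proof.
move=> /(_ [::] s isT isT) [u0 uN u1]; split => // [a /negP/uN //|].
by rewrite -u1 fsbig_setT.
Qed.

Lemma RH_shift T u s a : RH M T.+1 u -> a \in adm M s ->
  RH M T (shift_policy u (s, a)).
Proof. by move=> uRH aS h x hT hM; apply: uRH; rewrite //= aS. Qed.

Lemma sum_law T u s : RH M T u -> \sum_(w : T.-tuple _ * _) law M u s w = 1.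
Proof.
elim: T u s => [|T IH] u s uRH; under eq_bigr do rewrite -[law _ _ _ _]mulr1.
  by rewrite (@sum_law0 u s (fun=> 1)).
rewrite (@sum_law_recl T u s (fun=> 1)).
have [_ uN u1] := RH_action0 s uRH; rewrite -[RHS]u1; apply: eq_bigr => a _.
have [aS|/uN ->] := boolP (a \in adm M s); last by rewrite mul0r.
rewrite -[RHS]mulr1 -[X in _ = _ * X](sum_trans aS); congr (_ * _).
apply: eq_bigr => y _; under eq_bigr do rewrite /= mulr1.
by rewrite IH ?mulr1 //; exact: RH_shift.
Qed.

Lemma law_ge0 T u s (w : T.-tuple (S * A) * S) : RH M T u -> 0 <= law M u s w.
Proof.
elim: T u s w => [|T IH] u s [w y] uRH.
  by rewrite /law big_ord0 mulr1.
have -> : (w, y) = cons_traj (thead w) ([tuple of behead w], y).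
  by rewrite /cons_traj /= -tuple_eta.
case: (thead w) => x a; rewrite law_cons /=.
have [u0 uN _] := RH_action0 x uRH.
(* The sign of [trans] is unknown at an inadmissible action, but the policy gives it weight 0. *)
have [aS|/uN ->] := boolP (a \in adm M x); last by rewrite mul0r mulr0 mul0r.
apply: mulr_ge0; last by apply: IH; exact: RH_shift.
by rewrite !mulr_ge0 ?ler0n ?trans_ge0.
Qed.

Lemma cdfE T u s l :
  cdf M T u s l = \sum_(w : T.-tuple _ * _ | total_reward M w <= l) law M u s w.
Proof.
by rewrite /cdf (bigfs _ (index_enum_uniq _)) // => i _; rewrite mem_index_enum.
Qed.

Lemma cdf_sum T u s l :
  cdf M T u s l =
  \sum_(w : T.-tuple _ * _) law M u s w * (total_reward M w <= l)%R%:R.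
Proof.
rewrite cdfE big_mkcond /=; apply: eq_bigr => w _.
by case: ifP; rewrite ?mulr1 ?mulr0.
Qed.

Lemma cdf0 u s l : cdf M 0 u s l = (0 <= l)%R%:R.
Proof.
by rewrite cdf_sum sum_law0 /total_reward big_ord0.
Qed.

(** The first reward moves to the other side of [total_reward M w <= l], which lowers the level
    exactly as a step of the augmented MDP does. *)
Lemma cdf_recl T u s l :
  cdf M T.+1 u s l =
  \sum_a u [::] s a * \sum_y trans M s a y *
    cdf M T (shift_policy u (s, a)) y (l - rew M s a).
Proof.
rewrite cdf_sum sum_law_recl; apply: eq_bigr => a _; congr (_ * _).
apply: eq_bigr => y _; congr (_ * _); rewrite cdf_sum.
by apply: eq_bigr => w _; rewrite total_reward_cons lerBrDl.
Qed.

Definition best_action s (q : A -> R) : A :=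
  [arg min_(a < xchoose (adm_neq0 M s) in adm M s) q a]%O.

(** Optimal value of the augmented MDP with [T] steps to go and remaining level [l]. *)
Fixpoint opt_cdf (T : nat) (s : S) (l : R) : R :=
  if T is T'.+1 then
    let q a := \sum_y trans M s a y * opt_cdf T' y (l - rew M s a) in
    q (best_action s q)
  else (0 <= l)%R%:R.

Lemma best_action_adm s q : best_action s q \in adm M s.
Proof. by rewrite /best_action; case: arg_minP => //; exact: xchooseP. Qed.

Lemma best_actionP s q a : a \in adm M s -> q (best_action s q) <= q a.
Proof.
by rewrite /best_action; case: arg_minP => [|i _]; [exact: xchooseP|apply].
Qed.

Lemma opt_cdf_le T u s l : RH M T u -> opt_cdf T s l <= cdf M T u s l.
Proof.
elim: T u s l => [|T IH] u s l uRH; first by rewrite cdf0.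
have [u0 uN u1] := RH_action0 s uRH; rewrite cdf_recl /=.
(* The action weights sum to 1, so the left side becomes an average of a constant, to be compared
   action by action. *)
set q := fun a => \sum_y _; rewrite -[leLHS]mul1r -u1 mulr_suml.
apply: ler_sum => a _.
have [aS|/uN ->] := boolP (a \in adm M s); last by rewrite !mul0r.
apply: ler_wpM2l => //; apply: le_trans (best_actionP q aS) _.
apply: ler_sum => y _; apply: ler_wpM2l; first exact: trans_ge0.
by apply: IH; exact: RH_shift.
Qed.

(** After acting at time [t], [T - t.+1] steps remain. *)
Definition greedy (T : nat) : mpolicy (S * R)%type A := fun t x =>
  best_action x.1 (fun a => \sum_y trans M x.1 a y *
                             opt_cdf (T - t.+1) y (x.2 - rew M x.1 a)).

Lemma greedy_DM T : DM (aug M) T (greedy T).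
Proof. by move=> t x _; exact: best_action_adm. Qed.

(** The first reward is absorbed into the starting level, and the Markov policy advances by one time
    unit. *)
Lemma lift_policy_shift (v : mpolicy (S * R)%type A) l s a :
  shift_policy (rand R (lift_policy M l v)) (s, a) =
  rand R (lift_policy M (l - rew M s a) (fun t => v t.+1)).
Proof.
apply/funext => h; apply/funext => x; apply/funext => b.
by rewrite /shift_policy /rand /lift_policy /= big_cons /= opprD addrA.
Qed.

Lemma cdf_greedy T s l :
  cdf M T (rand R (lift_policy M l (greedy T))) s l = opt_cdf T s l.
Proof.
elim: T s l => [|T IH] s l; first by rewrite cdf0.
have aE : lift_policy M l (greedy T.+1) [::] s = greedy T.+1 0 (s, l).
  by rewrite /lift_policy big_nil subr0.
(* [greedy] depends on time only through the number of remaining steps. *)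
have gE : (fun t => greedy T.+1 t.+1) = greedy T.
  by apply/funext => t; apply/funext => x; rewrite /greedy subSS.
rewrite cdf_recl (bigD1 (greedy T.+1 0 (s, l))) //= [X in _ + X]big1 ?addr0.
  rewrite {1}/rand aE eqxx mul1r lift_policy_shift gE.
  by under eq_bigr do rewrite IH; rewrite /greedy /= subn1.
by move=> a /negPf aN; rewrite /rand aE aN mul0r.
Qed.

Lemma DH_RH T (u : dpolicy S A) : DH M T u -> RH M T (rand R u).
Proof.
move=> uDH h x hT hM; have uS := uDH h x hT hM; rewrite /rand; split => [a|a|].
- exact: ler0n.
- by move=> /= aN; case: eqP => // e; case: aN; rewrite e.
rewrite fsbig_setT.
rewrite (bigD1 (u h x)) //= eqxx big1 ?addr0 // => a /negPf -> //.
Qed.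

Lemma lift_policy_DH T (v : mpolicy (S * R)%type A) l :
  DM (aug M) T v -> DH M T (lift_policy M l v).
Proof.
by move=> vDM h s hT _; exact: (vDM (size h) (s, l - \sum_(z <- h) rew M z.1 z.2)).
Qed.

(** The lift of [greedy] attains the lower bound [opt_cdf], so the infimum is a minimum. *)
Lemma cdf_starE T s l : cdf_star M T s l = opt_cdf T s l.
Proof.
have gRH := DH_RH (lift_policy_DH l (@greedy_DM T)).
apply/eqP; rewrite eq_le; apply/andP; split.
  rewrite -cdf_greedy; apply: ge_inf.
    by exists (opt_cdf T s l) => _ [u uRH <-]; exact: opt_cdf_le.
  by exists (rand R (lift_policy M l (greedy T))).
apply: lb_le_inf.
  by exists (cdf M T (rand R (lift_policy M l (greedy T))) s l); eexists; [exact: gRH|].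
by move=> _ [u uRH <-]; exact: opt_cdf_le.
Qed.


(** * Value at risk as a quantile of the total reward *)

Lemma VaR_atom T alpha u s : 0 < alpha -> alpha <= 1 -> RH M T u ->
  exists w : T.-tuple (S * A) * S, VaR M T alpha u s = total_reward M w.
Proof.
move=> a0 a1 uRH; have cE : cdf M T u s = fun l =>
    \sum_(w : T.-tuple _ * _ | total_reward M w <= l) law M u s w.
  by apply/funext => m; exact: cdfE.
have [] := quantileP (@total_reward R S A M T)
  (fun w => law_ge0 s w uRH) (sum_law s uRH) a0 a1.
by rewrite /VaR cE.
Qed.

Lemma VaR_le T alpha u s l : 0 < alpha -> alpha <= 1 -> RH M T u ->
  (alpha <= cdf M T u s l) = (VaR M T alpha u s <= l).
Proof.
move=> a0 a1 uRH; have cE : cdf M T u s = fun l =>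
    \sum_(w : T.-tuple _ * _ | total_reward M w <= l) law M u s w.
  by apply/funext => m; exact: cdfE.
have [_] := quantileP (@total_reward R S A M T)
  (fun w => law_ge0 s w uRH) (sum_law s uRH) a0 a1.
by rewrite /VaR cE.
Qed.

End FiniteMdp.

(** * Correspondence between original and augmented trajectories *)

Section Trajectories.
Variables (X : choiceType) (A : finType) (T : nat).
Implicit Type w : T.-tuple (X * A) * X.

Lemma state_at_tnth w (t : 'I_T) : state_at w t = (tnth w.1 t).1.
Proof.
by rewrite /state_at (nth_map (tnth w.1 t)) ?size_tuple // -tnth_nth.
Qed.

Lemma state_at_last w : state_at w T = w.2.
Proof. by rewrite /state_at nth_default // size_map size_tuple. Qed.

End Trajectories.

Section AugmentedTrajectories.
Variables (R : realType) (S A : finType) (M : mdp R S A) (T : nat) (l : R).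
Implicit Types (w : T.-tuple (S * A) * S)
  (wa : T.-tuple ((S * R) * A) * (S * R)).

Definition level w (t : nat) : R :=
  l - \sum_(z <- take t w.1) rew M z.1 z.2.

(** The only augmented trajectory above [w] that starts at level [l] and obeys the level
    dynamics. *)
Definition aug_traj w : T.-tuple ((S * R) * A) * (S * R) :=
  ([tuple ((state_at w t, level w t), (tnth w.1 t).2) | t < T],
   (w.2, level w T)).

Definition proj_traj wa : T.-tuple (S * A) * S :=
  ([tuple of [seq (z.1.1, z.2) | z <- wa.1]], wa.2.1).

Lemma level0 w : level w 0 = l.
Proof. by rewrite /level take0 big_nil subr0. Qed.

Lemma levelS w (t : 'I_T) :
  level w t.+1 = level w t - rew M (state_at w t) (tnth w.1 t).2.
Proof.
rewrite /level (take_nth (tnth w.1 t)) ?size_tuple // -tnth_nth.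
by rewrite big_rcons /= state_at_tnth opprD addrA.
Qed.

Lemma level_last w : level w T = l - total_reward M w.
Proof.
rewrite /level take_oversize ?size_tuple // big_tuple; congr (_ - _).
by apply: eq_bigr => t _; rewrite state_at_tnth.
Qed.

Lemma state_at_aug w t : (t <= T)%N ->
  state_at (aug_traj w) t = (state_at w t, level w t).
Proof.
rewrite leq_eqVlt => /predU1P[->|tT]; first by rewrite !state_at_last.
by rewrite (state_at_tnth _ (Ordinal tT)) tnth_mktuple.
Qed.

Lemma state_at_proj wa t : (t <= T)%N ->
  state_at (proj_traj wa) t = (state_at wa t).1.
Proof.
rewrite leq_eqVlt => /predU1P[->|tT]; first by rewrite !state_at_last.
by rewrite !(state_at_tnth _ (Ordinal tT)) tnth_map.
Qed.

Lemma aug_trajK : cancel aug_traj proj_traj.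
Proof.
move=> [w y]; congr (_, _); apply: eq_from_tnth => t.
by rewrite tnth_map tnth_mktuple /= state_at_tnth /=; case: (tnth w t).
Qed.

(** Along [aug_traj] every level indicator in [aug_trans] equals 1, and both policies query [v] at
    the same time, state and level. *)
Lemma law_aug (v : mpolicy (S * R)%type A) s w :
  law (aug M) (rand R (dpolicy_of_markov v)) (s, l) (aug_traj w) =
  law M (rand R (lift_policy M l v)) s w.
Proof.
rewrite /law state_at_aug // level0 xpair_eqE eqxx andbT; congr (_ * _).
apply: eq_bigr => t _.
have tT : (t <= T)%N by exact: ltnW.
rewrite /rand /dpolicy_of_markov /lift_policy !size_takel ?size_tuple //.
by rewrite !state_at_aug //= /aug_trans levelS tnth_mktuple eqxx mulr1.
Qed.

(** A nonzero product has no zero factor: the initial indicator fixes the first level and each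
    transition indicator fixes the next one. *)
Lemma law_aug_supp (u : rpolicy R (S * R)%type A) s wa :
  law (aug M) u (s, l) wa != 0 -> wa = aug_traj (proj_traj wa).
Proof.
rewrite mulf_eq0 negb_or => /andP[w0 wS].
have lvl t : (t <= T)%N -> (state_at wa t).2 = level (proj_traj wa) t.
  elim: t => [_|t IH tT].
    by move: w0; rewrite pnatr_eq0 eqb0 negbK level0 => /eqP ->.
  have /prodf_neq0/(_ (Ordinal tT) isT) := wS.
  rewrite /= /aug_trans; case: (eqVneq (state_at wa t.+1).2) => [-> _|_].
    rewrite (levelS _ (Ordinal tT)) /= state_at_proj ?(ltnW tT) //.
    by rewrite tnth_map /= IH // ltnW.
  by rewrite !mulr0 eqxx.
have stE t : (t <= T)%N ->
    state_at wa t = (state_at (proj_traj wa) t, level (proj_traj wa) t).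
  by move=> tT; rewrite -lvl // state_at_proj //; case: (state_at wa t).
rewrite [LHS]surjective_pairing; congr (_, _).
  apply: eq_from_tnth => t; rewrite tnth_mktuple -stE ?(ltnW (ltn_ord t)) //.
  by rewrite state_at_tnth tnth_map /=; case: (tnth wa.1 t).
by rewrite -state_at_last stE // state_at_last.
Qed.

(** The image of [aug_traj] carries all the mass, and there the terminal test
    [0 <= l - total_reward M w] is the event measured by [cdf]. *)
Lemma aug_valueE (v : mpolicy (S * R)%type A) s :
  aug_value M T v s l = cdf M T (rand R (lift_policy M l v)) s l.
Proof.
rewrite /aug_value /expectation -(@fsbig_widen _ _ _ _ (aug_traj @` setT)) //.
  rewrite fsbig_image; last by move=> w1 w2 _ _; exact: (can_inj aug_trajK).
  rewrite fsbig_setT cdf_sum; apply: eq_bigr => w _.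
  by rewrite law_aug state_at_aug // /aug_terminal /= level_last subr_ge0.
move=> wa [_ waN] /=; set p := law _ _ _ _.
have [->|/law_aug_supp waE] := eqVneq p 0; first by rewrite mul0r.
by case: waN; exists (proj_traj wa).
Qed.

End AugmentedTrajectories.

(** * Monotone improvement, optimality at stopping, and termination *)

Section PolicyIteration.
Variables (R : realType) (S A : finType) (M : mdp R S A) (T : nat).
Variables (alpha : R) (s0 : S).

Lemma greedy_argmin l : aug_argmin M T s0 l (greedy M T).
Proof.
split=> [|v vDM]; first exact: greedy_DM.
rewrite !aug_valueE cdf_greedy; apply: opt_cdf_le.
exact/DH_RH/lift_policy_DH.
Qed.

Lemma improvement_DH u u' : improvement M T alpha s0 u u' -> DH M T u'.
Proof. by case=> v [vDM _] ->; exact: lift_policy_DH. Qed.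

Lemma improvement_cdf u u' : improvement M T alpha s0 u u' ->
  let l := VaR M T alpha (rand R u) s0 in
  cdf M T (rand R u') s0 l = cdf_star M T s0 l.
Proof.
set l := VaR _ _ _ _ _; case=> v [vDM vmin] -> /=; rewrite cdf_starE.
apply/eqP; rewrite eq_le opt_cdf_le ?andbT; last exact/DH_RH/lift_policy_DH.
(* The arbitrary minimizer [v] is compared with [greedy], whose value is [opt_cdf]. *)
by rewrite -aug_valueE -cdf_greedy -aug_valueE vmin //; exact: greedy_DM.
Qed.

Hypotheses (a0 : 0 < alpha) (a1 : alpha <= 1).

Lemma improvement_VaR_lt u u' : continues M T alpha s0 u ->
  improvement M T alpha s0 u u' ->
  VaR M T alpha (rand R u) s0 < VaR M T alpha (rand R u') s0.
Proof.
move=> cu uu'; have u'RH := DH_RH (improvement_DH uu').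
by rewrite ltNge -(VaR_le _ _ a0 a1 u'RH) improvement_cdf // -ltNge.
Qed.

Lemma VaR_optimal u : DH M T u -> ~~ continues M T alpha s0 u ->
  VaR M T alpha (rand R u) s0 = VaR_star M T alpha s0.
Proof.
move=> /DH_RH uRH; rewrite /continues -leNgt cdf_starE => aF.
have VaR_max u1 : RH M T u1 -> VaR M T alpha u1 s0 <= VaR M T alpha (rand R u) s0.
  move=> u1RH; rewrite -VaR_le //; apply: le_trans aF _; exact: opt_cdf_le.
apply/eqP; rewrite eq_le; apply/andP; split.
  (* [VaR_max] also supplies the upper bound that makes [sup] meaningful. *)
  apply: ub_le_sup; last by exists (rand R u).
  by exists (VaR M T alpha (rand R u) s0) => _ [u1 /VaR_max ? <-].
apply: ge_sup; first by exists (VaR M T alpha (rand R u) s0), (rand R u).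
by move=> _ [u1 /VaR_max ? <-].
Qed.

Lemma execution_DH run : DH M T (run 0%N) -> execution M T alpha s0 run ->
  forall n, (forall k, (k < n)%N -> continues M T alpha s0 (run k)) ->
  DH M T (run n).
Proof. by move=> r0 ex [|n] cn //; apply/improvement_DH/ex/cn. Qed.

Lemma execution_stops run : DH M T (run 0%N) -> execution M T alpha s0 run ->
  exists n, ~~ continues M T alpha s0 (run n).
Proof.
move=> r0 ex; apply: contrapT => /forallNP allc.
have {allc} cont k : continues M T alpha s0 (run k) by apply: contrapT => /negP/allc.
pose V k := VaR M T alpha (rand R (run k)) s0.
have V_lt : {homo V : i j / (i < j)%N >-> i < j}.
  apply: homo_ltn; first exact: lt_trans.
  by move=> k; apply: improvement_VaR_lt => //; exact: ex.
have V_inj : injective V.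
  move=> i j Vij; apply/eqP; case: (ltngtP i j) => // /V_lt.
    by rewrite Vij ltxx.
  by rewrite Vij ltxx.
have /boolp.choice[w wE] :
    forall k, exists w : T.-tuple (S * A) * S, V k = total_reward M w.
  by move=> k; apply: VaR_atom => //; exact/DH_RH/execution_DH.
(* Pigeonhole: one more iteration than there are trajectories, yet the trajectories realizing the
   distinct values [V k] must differ. *)
have w_inj : injective (fun i : 'I_(#|{: T.-tuple (S * A) * S}|.+1) => w i).
  by move=> i j wij; apply/val_inj/V_inj; rewrite !wE wij.
by have := leq_card _ w_inj; rewrite card_ord ltnn.
Qed.

End PolicyIteration.

Theorem theorem6 (R : realType) (S A : finType) (M : mdp R S A) (T : nat)
    (alpha : R) (s0 : S) (hT : (1 <= T)%N) (h0 : 0 < alpha) (h1 : alpha <= 1) :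
  (forall u : dpolicy S A, DH M T u ->
     exists u', improvement M T alpha s0 u u') /\
  (forall run : nat -> dpolicy S A, DH M T (run 0%N) ->
     execution M T alpha s0 run ->
     exists n, stops_at M T alpha s0 run n /\
       DH M T (run n) /\
       VaR M T alpha (rand R (run n)) s0 = VaR_star M T alpha s0).
Proof.
split=> [u _|run r0 ex].
  by eexists; exists (greedy M T); [exact: greedy_argmin|].
(* The least non-continuing index is the stopping time, since all earlier policies must continue. *)
have [n nP nmin] := ex_minnP (execution_stops h0 h1 r0 ex).
have cont k : (k < n)%N -> continues M T alpha s0 (run k).
  by move=> kn; apply: contraT => /nmin; rewrite leqNgt kn.
have rn := execution_DH r0 ex cont.
by exists n; split=> //; split=> //; exact: VaR_optimal.
Qed.
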